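(* Let $f\in L^2(\mathbb{R}^2;\mathbb{H})$ (also integrable over $\mathbb{R}^2$), and let $f_\pm=\frac12(f\pm i f j)$. Then the quaternion Fourier transforms $\hat f_\pm$ of $f_\pm$ satisfy, for all $\mathbf{u}=(u,v)\in\mathbb{R}^2$ and with $\mathbf{x}=(x,y)$, $$\hat f_{\pm}(\mathbf{u})=\int_{\mathbb{R}^2}f_{\pm}(\mathbf{x})\,e^{-j(yv\mp xu)}\,d^2\mathbf{x}=\int_{\mathbb{R}^2}e^{-i(xu\mp yv)}\,f_{\pm}(\mathbf{x})\,d^2\mathbf{x},$$ where upper signs are taken together and lower signs are taken together.
   Context: $\mathbb{H}$ is the real quaternion algebra with units $i,j,k$, $ij=-ji=k$, $jk=-kj=i$, $ki=-ik=j$, $i^2=j^2=k^2=ijk=-1$, with $|q|=\sqrt{q_r^2+q_i^2+q_j^2+q_k^2}$ for $q=q_r+q_i i+q_j j+q_k k$. $L^2(\mathbb{R}^2;\mathbb{H})$ is the set of functions $f:\mathbb{R}^2\to\mathbb{H}$ with $\int_{\mathbb{R}^2}|f(\mathbf{x})|^2\,d^2\mathbf{x}<\infty$. The quaternion Fourier transform (QFT) of $f$ is $$\hat f(\mathbf{u})=\int_{\mathbb{R}^2}e^{-i xu}\,f(\mathbf{x})\,e^{-j yv}\,d^2\mathbf{x},\qquad \mathbf{x}=(x,y),\ \mathbf{u}=(u,v),\ d^2\mathbf{x}=dx\,dy.$$ *)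

(* Defs.v *)
From HB Require Import structures.
From mathcomp Require Import all_boot all_order all_algebra.
From mathcomp Require Import all_classical all_reals all_analysis.
From mathcomp Require Import ring.
Set Implicit Arguments.
Unset Strict Implicit.
Unset Printing Implicit Defensive.
Import Order.TTheory GRing.Theory Num.Theory.
Import numFieldNormedType.Exports.

Local Open Scope classical_set_scope.
Local Open Scope ring_scope.

Record quat (R : Type) := Quat { qr : R; qi : R; qj : R; qk : R }.

Definition quat_to (R : Type) (q : quat R) : R * R * R * R :=
  (qr q, qi q, qj q, qk q).
Definition quat_of (R : Type) (x : R * R * R * R) : quat R :=
  let: (a, b, c, d) := x in Quat a b c d.

Lemma quat_toK (R : Type) : cancel (@quat_to R) (@quat_of R).
Proof. by case. Qed.

HB.instance Definition _ (R : eqType) :=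
  Equality.copy (quat R) (can_type (@quat_toK R)).
HB.instance Definition _ (R : choiceType) :=
  Choice.copy (quat R) (can_type (@quat_toK R)).

Section QuatAlgebra.
Variable R : comNzRingType.
Implicit Types (p q s : quat R) (a b : R).

Definition qadd p q :=
  Quat (qr p + qr q) (qi p + qi q) (qj p + qj q) (qk p + qk q).
Definition qopp q := Quat (- qr q) (- qi q) (- qj q) (- qk q).
Definition qscale a q := Quat (a * qr q) (a * qi q) (a * qj q) (a * qk q).
Definition qone : quat R := Quat 1 0 0 0.
(* The bilinear extension of i^2 = j^2 = k^2 = -1, ij = -ji = k,
   jk = -kj = i, ki = -ik = j. *)
Definition qmul p q :=
  Quat (qr p * qr q - qi p * qi q - qj p * qj q - qk p * qk q)
       (qr p * qi q + qi p * qr q + qj p * qk q - qk p * qj q)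
       (qr p * qj q - qi p * qk q + qj p * qr q + qk p * qi q)
       (qr p * qk q + qi p * qj q - qj p * qi q + qk p * qr q).

Fact qaddA : associative qadd.
Proof. by move=> p q s; rewrite /qadd /= !addrA. Qed.
Fact qaddC : commutative qadd.
Proof. by move=> p q; rewrite /qadd; congr Quat; rewrite addrC. Qed.
Fact qadd0 : left_id (Quat 0 0 0 0) qadd.
Proof. by case=> *; rewrite /qadd /= !add0r. Qed.
Fact qaddN : left_inverse (Quat 0 0 0 0) qopp qadd.
Proof. by case=> *; rewrite /qadd /= !addNr. Qed.

HB.instance Definition _ :=
  GRing.isZmodule.Build (quat R) qaddA qaddC qadd0 qaddN.

Fact qmulA : associative qmul.
Proof. by move=> p q s; rewrite /qmul; congr Quat => /=; ring. Qed.
Fact qmul1q : left_id qone qmul.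
Proof. by case=> *; rewrite /qmul; congr Quat => /=; ring. Qed.
Fact qmulq1 : right_id qone qmul.
Proof. by case=> *; rewrite /qmul; congr Quat => /=; ring. Qed.
Fact qmulDl : left_distributive qmul qadd.
Proof. by move=> p q s; rewrite /qmul; congr Quat => /=; ring. Qed.
Fact qmulDr : right_distributive qmul qadd.
Proof. by move=> p q s; rewrite /qmul; congr Quat => /=; ring. Qed.
Fact qone_neq0 : qone != 0.
Proof. by apply/eqP => -[] /eqP; rewrite oner_eq0. Qed.

HB.instance Definition _ := GRing.Zmodule_isNzRing.Build (quat R)
  qmulA qmul1q qmulq1 qmulDl qmulDr qone_neq0.

Fact qscaleA a b q : qscale a (qscale b q) = qscale (a * b) q.
Proof. by rewrite /qscale /= !mulrA. Qed.
Fact qscale1 : left_id 1 qscale.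
Proof. by case=> *; rewrite /qscale /= !mul1r. Qed.
Fact qscaleDr : right_distributive qscale +%R.
Proof. by move=> a p q; rewrite /qscale; congr Quat => /=; ring. Qed.
Fact qscaleDl q : {morph qscale^~ q : a b / a + b}.
Proof. by move=> a b; rewrite /qscale; congr Quat => /=; ring. Qed.

HB.instance Definition _ := GRing.Zmodule_isLmodule.Build R (quat R)
  qscaleA qscale1 qscaleDr qscaleDl.

Fact qscaleAl a p q : a *: (p * q) = a *: p * q.
Proof.
by rewrite -[LHS]/(qscale _ (qmul _ _)) /qscale; congr Quat => /=; ring.
Qed.
HB.instance Definition _ :=
  GRing.Lmodule_isLalgebra.Build R (quat R) qscaleAl.

Fact qscaleAr a p q : a *: (p * q) = p * (a *: q).
Proof.
by rewrite -[LHS]/(qscale _ (qmul _ _)) /qscale; congr Quat => /=; ring.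
Qed.
HB.instance Definition _ :=
  GRing.Lalgebra_isAlgebra.Build R (quat R) qscaleAr.

Definition uniti : quat R := Quat 0 1 0 0.
Definition unitj : quat R := Quat 0 0 1 0.
Definition unitk : quat R := Quat 0 0 0 1.

End QuatAlgebra.

Section QuatAnalysis.
Variable R : realType.
Implicit Types (q : quat R) (f : R * R -> quat R).

Definition qnorm q : R :=
  Num.sqrt (qr q ^+ 2 + qi q ^+ 2 + qj q ^+ 2 + qk q ^+ 2).

(* The partial sums of e^q = \sum_n q^n / n!; convergence in quat R is
   componentwise. *)
Definition qexp_sum q : (quat R)^nat :=
  fun n => \sum_(0 <= m < n) m`!%:R^-1 *: q ^+ m.

Definition qexp q : quat R :=
  Quat (limn (fun n => qr (qexp_sum q n))) (limn (fun n => qi (qexp_sum q n)))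
       (limn (fun n => qj (qexp_sum q n))) (limn (fun n => qk (qexp_sum q n))).

Definition leb2 := ((@lebesgue_measure R) \x (@lebesgue_measure R))%E.

Definition qborel f : Prop :=
  [/\ measurable_fun [set: R * R] (@qr R \o f),
      measurable_fun [set: R * R] (@qi R \o f),
      measurable_fun [set: R * R] (@qj R \o f) &
      measurable_fun [set: R * R] (@qk R \o f)].

(* Lebesgue measurability, i.e. for the completed product measure; leb2 itself
   lives on the Borel sets of the plane. *)
Definition qmeasurable f : Prop :=
  exists2 g : R * R -> quat R, qborel g & {ae leb2, forall x, f x = g x}.

Definition qL1 f : Prop :=
  qmeasurable f /\ (\int[leb2]_x (qnorm (f x))%:E < +oo)%E.

Definition qL2 f : Prop :=
  qmeasurable f /\ (\int[leb2]_x (qnorm (f x) ^+ 2)%:E < +oo)%E.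

(* The library integral is a supremum over Borel simple functions below the
   positive and negative parts, so it has the expected value also on functions
   that are only Lebesgue measurable. *)
Definition qint f : quat R :=
  Quat (Rintegral leb2 setT (@qr R \o f)) (Rintegral leb2 setT (@qi R \o f))
       (Rintegral leb2 setT (@qj R \o f)) (Rintegral leb2 setT (@qk R \o f)).

Definition QFT f (u : R * R) : quat R :=
  qint (fun x => qexp (- (x.1 * u.1) *: uniti R) * f x
                 * qexp (- (x.2 * u.2) *: unitj R)).

Definition fplus f : R * R -> quat R :=
  fun x => 2^-1 *: (f x + uniti R * f x * unitj R).
Definition fminus f : R * R -> quat R :=
  fun x => 2^-1 *: (f x - uniti R * f x * unitj R).

End QuatAnalysis.

(* Main.v *)
Require Import Defs.
From mathcomp Require Import all_boot all_order all_algebra.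
From mathcomp Require Import all_classical all_reals all_analysis.
From mathcomp Require Import ring.
Import GRing.Theory numFieldNormedType.Exports.
Local Open Scope ring_scope.

(** The identity holds already between the integrands. For a quaternion [w]
    with [w^2 = -1] one has [e^(t w) = cos t + (sin t) w], so a relation
    [w g = g w'] between two such units propagates to
    [e^(t w) g = g e^(t w')]. Since [i^2 = j^2 = -1], the two parts satisfy
    [i f_+ = f_+ (-j)] and [i f_- = f_- j], and either exponential of the
    kernel can be moved across them to the other side. *)

Lemma uniti_sqr (R : comNzRingType) : uniti R * uniti R = -1.
Proof. by rewrite -[LHS]/(qmul _ _) /qmul; congr Quat => /=; ring. Qed.

Lemma unitj_sqr (R : comNzRingType) : unitj R * unitj R = -1.
Proof. by rewrite -[LHS]/(qmul _ _) /qmul; congr Quat => /=; ring. Qed.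

(** The exponents are those of [cos_coeff] and [sin_coeff], so even powers feed the cosine series
    and odd powers the sine series. *)
Lemma exprn_sqrN1 (R : comNzRingType) (A : algType R) (w : A) (n : nat) :
  w * w = -1 ->
  w ^+ n = if odd n then (-1) ^+ n.-1./2 *: w else ((-1) ^+ n./2)%:A.
Proof.
move=> ww; rewrite -[in LHS](odd_double_half n) exprD -mul2n exprM expr2 ww.
rewrite -[-1 : A]scaleN1r exprZn expr1n -scalerAr mulr1.
by case: n => [|n] //=; case: (boolP (odd n)) => n_odd //=;
  rewrite uphalf_half (negbTE n_odd) expr1.
Qed.

Section UnitExponential.
Variable R : realType.
Implicit Types (w g : quat R) (s t : R).

Lemma qexp_sum_unit w t n : w * w = -1 ->
  qexp_sum (t *: w) n =
    (series (cos_coeff t) n)%:A + series (sin_coeff t) n *: w.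
Proof.
move=> ww; rewrite /qexp_sum /series !scaler_suml -big_split /=.
apply: eq_bigr => m _; rewrite exprZn (exprn_sqrN1 _ _ w)//=.
rewrite /cos_coeff /sin_coeff /= -exprnP.
by case: (odd m); rewrite !scalerA /= !mul0r scale0r (add0r, addr0);
  congr (_ *: _); ring.
Qed.

Lemma qexp_unit w t : w * w = -1 ->
  qexp (t *: w) = (cos t)%:A + sin t *: w.
Proof.
move=> ww.
have lim_lin (a b : R) :
    limn (fun n => series (cos_coeff t) n * a + series (sin_coeff t) n * b)
    = cos t * a + sin t * b.
  apply/cvg_lim => //; rewrite cos.unlock sin.unlock.
  by apply: cvgD; apply: cvgM (cvg_cst _);
    [exact: is_cvg_series_cos_coeff | exact: is_cvg_series_sin_coeff].
(* The factors [1] and [0] are the components of the quaternion unit; keeping them lets [lim_lin]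
   treat all four components alike. *)
rewrite /qexp -[RHS]/(Quat (cos t * 1 + sin t * qr w) (cos t * 0 + sin t * qi w)
  (cos t * 0 + sin t * qj w) (cos t * 0 + sin t * qk w)).
by congr Quat; rewrite -lim_lin; congr (limn _); apply/funext => n;
  rewrite qexp_sum_unit.
Qed.

Lemma qexp_intertwine w w' g t : w * w = -1 -> w' * w' = -1 ->
  w * g = g * w' -> qexp (t *: w) * g = g * qexp (t *: w').
Proof.
move=> ww ww' wg; rewrite !qexp_unit// mulrDl mulrDr -!scalerAl -!scalerAr.
by rewrite mul1r mulr1 wg.
Qed.

(** Both factors lie in the span of [1] and [w], a copy of the complex numbers, so this amounts to
    the addition formulas for [cos] and [sin]. *)
Lemma qexp_unitD w s t : w * w = -1 ->
  qexp (s *: w) * qexp (t *: w) = qexp ((s + t) *: w).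
Proof.
move=> ww; rewrite !qexp_unit// mulrDl !mulrDr -!scalerAl -!scalerAr.
rewrite !mul1r mulr1 ww !scalerA scalerN cosD sinD scalerBl scalerDl.
by rewrite [LHS](AC (2*2) ((1*4)*(3*2))).
Qed.

End UnitExponential.

(** Either product exchanges the two summands of [fplus f x]: both sides are half of [i f - f j]. *)
Lemma uniti_fplus (R : realType) (f : R * R -> quat R) x :
  uniti R * fplus f x = fplus f x * - unitj R.
Proof.
rewrite /fplus -scalerAr -scalerAl mulrDr mulrDl !mulrN -!mulrA unitj_sqr.
by rewrite !mulrA uniti_sqr mulN1r mulrN1 opprK addrC mulNr.
Qed.

Lemma uniti_fminus (R : realType) (f : R * R -> quat R) x :
  uniti R * fminus f x = fminus f x * unitj R.
Proof.
rewrite /fminus -scalerAr -scalerAl mulrBr mulrBl -!mulrA unitj_sqr.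
by rewrite !mulrA uniti_sqr mulN1r mulrN1 mulNr !opprK addrC.
Qed.

Lemma eq_qint (R : realType) (g h : R * R -> quat R) :
  g =1 h -> qint g = qint h.
Proof. by move=> /funext ->. Qed.

Theorem theorem4p1 (R : realType) (f : R * R -> quat R)
    (f_L2 : qL2 f) (f_L1 : qL1 f) (u v : R) :
  (QFT (fplus f) (u, v) =
     qint (fun x => fplus f x * qexp (- (x.2 * v - x.1 * u) *: unitj R)) /\
   QFT (fplus f) (u, v) =
     qint (fun x => qexp (- (x.1 * u - x.2 * v) *: uniti R) * fplus f x)) /\
  (QFT (fminus f) (u, v) =
     qint (fun x => fminus f x * qexp (- (x.2 * v + x.1 * u) *: unitj R)) /\
   QFT (fminus f) (u, v) =
     qint (fun x => qexp (- (x.1 * u + x.2 * v) *: uniti R) * fminus f x)).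
Proof.
have ii := uniti_sqr R; have jj := unitj_sqr R.
have njj : - unitj R * - unitj R = -1 by rewrite mulrNN.
have plus_comm x t : qexp (t *: uniti R) * fplus f x
    = fplus f x * qexp (- t *: unitj R).
  by rewrite scaleNr -scalerN; apply/qexp_intertwine/uniti_fplus.
have minus_comm x t : qexp (t *: uniti R) * fminus f x
    = fminus f x * qexp (t *: unitj R).
  exact/qexp_intertwine/uniti_fminus.
(* The sum is a separate variable [r], so that matching the exponents becomes a side goal for
   [ring]. *)
have jD g s t r : s + t = r ->
    g * qexp (s *: unitj R) * qexp (t *: unitj R) = g * qexp (r *: unitj R).
  by move=> <-; rewrite -mulrA (qexp_unitD _ _ _ _ jj).
(* An unrestricted [plus_comm] would also compare the two distinct arguments of
   [qexp] by unfolding its limits, which does not terminate in practice. *)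
rewrite /QFT; split; split; apply: eq_qint => x /=.
- by rewrite plus_comm; apply: jD; ring.
(* The exponential on the right-hand side is moved across too, so both sides become [fplus f x]
   times exponentials in [j]. *)
- by rewrite [X in X * _ = _]plus_comm [RHS]plus_comm; apply: jD; ring.
- by rewrite minus_comm; apply: jD; ring.
- by rewrite [X in X * _ = _]minus_comm [RHS]minus_comm; apply: jD; ring.
Qed.
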